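(* For every positive integer $m$, the orbit Cayley graph $Cay(Z_2^{4m+2},S_0\cup S_1)$ is strongly regular with parameters $$\left(2^{4m+2},\;2^{4m+1}+(-1)^m2^{2m}-1,\;2^{4m}+(-1)^m2^{2m}-2,\;2^{4m}+(-1)^m2^{2m}\right).$$
   Context: $Z_2^n$ is the elementary abelian $2$-group of rank $n$, viewed as the vector space $F_2^n$; here $n=4m+2$. For $v\in Z_2^n$, $|v|$ is the number of coordinates equal to $1$, and $O_i=\{v\in Z_2^n : |v|=i\}$ for $0\le i\le n$. Set $S_0=\bigcup_{i\neq 0,\ i\equiv 0 \,(\mathrm{mod}\ 4)}O_i$ and, for $a\in\{1,2,3\}$, $S_a=\bigcup_{i\equiv a\,(\mathrm{mod}\ 4)}O_i$, with $0\le i\le n$. For a group $G$ and $S\subseteq G$ with $1\notin S$ and $S=S^{-1}$, the Cayley graph $Cay(G,S)$ has vertex set $G$, with $x,y$ adjacent iff $x^{-1}y\in S$; it is called an orbit Cayley graph over $Z_2^n$ if $G=Z_2^n$ and $S$ is a union of some of the $O_i$. A strongly regular graph with parameters $(N,r,\lambda,\mu)$ is a connected $r$-regular graph on $N$ vertices in which any two adjacent vertices have exactly $\lambda$ common neighbours and any two distinct non-adjacent vertices have exactly $\mu$ common neighbours. *)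

(* Defs.v *)
From mathcomp Require Import all_boot all_order all_fingroup all_algebra.

Set Implicit Arguments.
Unset Strict Implicit.
Unset Printing Implicit Defensive.

Import GRing.Theory.

Local Open Scope ring_scope.

(* A graph is an adjacency relation on a finite vertex type. *)

Definition common_neighbours (V : finType) (e : rel V) (x y : V) : {set V} :=
  [set z | e x z && e y z].

(* The parameters are integers, so that formulas with signs can be used without
   truncated subtraction. *)
Definition strongly_regular (V : finType) (e : rel V) (N r lam mu : int) :
    Prop :=
  (symmetric e /\ irreflexive e) /\
  (forall x y : V, connect e x y) /\
  #|V|%:Z = N /\
  (forall x : V, #|[set y | e x y]|%:Z = r) /\
  (forall x y : V, e x y -> #|common_neighbours e x y|%:Z = lam) /\
  (forall x y : V,
     x != y -> ~~ e x y -> #|common_neighbours e x y|%:Z = mu).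

Definition connection_set (gT : finGroupType) (S : {set gT}) : Prop :=
  (1%g \notin S) /\ S = (S^-1)%g.

Definition Cay (gT : finGroupType) (S : {set gT}) : rel gT :=
  fun x y => (x^-1 * y)%g \in S.

(* The group law of row vectors is addition (inherited from their finZmodType
   structure): x * y, x^-1 and 1 in group_scope are x + y, - x and 0. *)
Definition Z2pow (n : nat) : finGroupType := 'rV['F_2]_n.

Definition weight (n : nat) (v : 'rV['F_2]_n) : nat :=
  #|[set i : 'I_n | v 0 i == 1]|.

Definition orb (n i : nat) : {set Z2pow n} :=
  [set v : 'rV['F_2]_n | weight v == i].

Definition S0 (n : nat) : {set Z2pow n} :=
  \bigcup_(i < n.+1 | (i != 0%N :> nat) && (i == 0 %[mod 4])) orb n i.

(* Used for a = 1, 2, 3 only: unlike S0, it would contain the zero vector for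
   a = 0. *)
Definition Sres (n a : nat) : {set Z2pow n} :=
  \bigcup_(i < n.+1 | i == a %[mod 4]) orb n i.

Definition orbit_connection_set (n : nat) (S : {set Z2pow n}) : Prop :=
  connection_set S /\
  exists I : {set 'I_n.+1}, S = \bigcup_(i in I) orb n i.

(* Main.v *)
Require Import Defs.
From mathcomp Require Import all_boot all_order all_fingroup all_algebra.
From mathcomp Require Import all_field ring zify.

Local Open Scope ring_scope.
Import GRing.Theory Num.Theory.

(** Write |v| for the weight of v. The sign q(v) = (-1)^C(|v|,2) is 1 when |v| is
    0 or 1 mod 4 and -1 when |v| is 2 or 3 mod 4, so the connection set D is
    {q = 1} minus the zero vector, with indicator (1 + q) / 2 away from zero.
    Since C(|v|,2) is the quadratic form sum_(i < j) v_i v_j, and this form is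
    nondegenerate in even dimension n, q is a bent function: for u <> 0,
      sum_v q(v) q(v + u) = 0   [qsign_orthogonal].
    Bent functions give strongly regular graphs. For x <> y, the number of z
    with q(x + z) = q(y + z) = 1 is
      1/4 sum_z (1 + q(x + z)) (1 + q(y + z)) = (2^n + 2 sum_v q(v)) / 4
    [card_low_weight2], which does not depend on x and y. The vertices x and y
    themselves are among these z exactly when they are adjacent, because
    q(0) = 1; this is why
    lambda = mu - 2 [card_common_neighbours].

    There remains the value of sum_v q(v). As 2 q(v) is equal to
    (1 - i) i^|v| + (1 + i) (-i)^|v|, and sum_v c^|v| = (1 + c)^n, the sum
    reduces to powers of 1 + i and 1 - i, whose fourth powers are both -4. This
    is where the sign (-1)^m comes from [sum_qsign]. Since the resulting mu is positive, any two vertices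
    are at distance at most 2, so the graph is connected. *)

(** * The quadratic sign of a weight *)

Definition qsign (k : nat) : int := ((-1) ^+ 'C(k, 2))%R.

Lemma qsignS k : qsign k.+1 = (-1) ^+ k * qsign k.
Proof. by rewrite /qsign binS bin1 exprD mulrC. Qed.

Lemma qsignD4 k : qsign (k + 4) = qsign k.
Proof.
rewrite !addnS addn0 !qsignS !exprS.
by rewrite -(signr_odd _ k); case: (odd k); ring.
Qed.

(** The weights 0 and 1 mod 4 selected by the connection set are those on which
    the quadratic sign is positive. *)
Lemma qsign_mod4 k : qsign k = if (k %% 4 < 2)%N then 1 else -1.
Proof.
rewrite {1}(divn_eq k 4); have := ltn_pmod k (isT : (0 < 4)%N).
elim: (k %/ 4)%N => [|q IHq] lt4; last first.
  by rewrite mulSn addnC addnA addnAC qsignD4 addnC -IHq // addnC.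
by rewrite mul0n add0n; move: (k %% 4)%N lt4; do 4?case.
Qed.

(** * Vectors over the field with two elements *)

Lemma F2_cases (a : 'F_2) : a = 0 \/ a = 1.
Proof. by case: a => [[|[|a]] lt_a] //; [left | right]; apply: val_inj. Qed.

Lemma sign_F2D (R : comNzRingType) (a b : 'F_2) :
  (-1) ^+ (a + b == 1) = (-1) ^+ (a == 1) * (-1) ^+ (b == 1) :> R.
Proof.
by rewrite -signr_addb; case: (F2_cases a) => ->; case: (F2_cases b) => ->.
Qed.

Section Weight.
Variable n : nat.
Implicit Types u v w : 'rV['F_2]_n.

Lemma addvv v : v + v = 0.
Proof.
apply/rowP => i; rewrite !mxE.
by case: (F2_cases (v 0 i)) => ->; apply: val_inj.
Qed.

Lemma oppv v : - v = v.
Proof. by apply/eqP; rewrite eq_sym -addr_eq0 addvv. Qed.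

Lemma weight_sum v : weight v = (\sum_i (v 0%R i == 1%R))%N.
Proof.
rewrite /weight -sum1_card big_mkcond.
by apply: eq_bigr => i _; rewrite inE; case: eqP.
Qed.

Lemma weight0 : weight (0 : 'rV['F_2]_n) = 0%N.
Proof. by rewrite weight_sum big1 // => i _; rewrite mxE. Qed.

(** The parity of the weight is the sum of the coordinates, hence linear. *)
Lemma sign_weightD (R : comNzRingType) u v :
  (-1) ^+ weight (u + v) = (-1) ^+ weight u * (-1) ^+ weight v :> R.
Proof.
rewrite !weight_sum !expr_sum -big_split; apply: eq_bigr => i _ /=.
by rewrite mxE sign_F2D.
Qed.

(** Flipping coordinate j changes the quadratic form by the sum of the other
    coordinates, whose parity is that of |v| + v_j. *)
Lemma qsign_flip v j :
  qsign (weight (v + delta_mx 0 j)) =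
    (-1) ^+ (weight v + (v 0 j == 1)) * qsign (weight v).
Proof.
have wE w : weight w = ((w 0%R j == 1%R) + \sum_(i | i != j) (w 0%R i == 1%R))%N.
  by rewrite weight_sum (bigD1 j).
rewrite !wE; set r := (\sum_(i | _) (v 0%R i == _))%N.
have -> : (\sum_(i | i != j) ((v + delta_mx 0 j)%R 0%R i == 1%R) = r)%N.
  by apply: eq_bigr => i /negPf ne_ij; rewrite !mxE ne_ij addr0.
rewrite !mxE !eqxx.
case: (F2_cases (v 0 j)) => -> /=; first by rewrite add0n addn0 qsignS.
rewrite add1n add0n qsignS addn1 !exprS.
by rewrite !mulN1r opprK mulrA -expr2 sqrr_sign mul1r.
Qed.

(** By qsign_flip, translating v by the j-th basis vector multiplies
    q(v) q(v + u) by the constant sign (-1)^(|u| + u_j). If some j makes this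
    sign negative, the sum is equal to its own opposite. *)
Lemma qsign_orthogonal u : ~~ odd n -> u != 0 ->
  \sum_v qsign (weight v) * qsign (weight (v + u)) = 0.
Proof.
move=> even_n u_neq0.
have [j uj] : exists j, odd (weight u + (u 0 j == 1%R)).
  case odd_u: (odd (weight u)).
    (* A zero coordinate exists: otherwise |u| would be the even number n. *)
    have [j uj|u1] := pickP (fun j => u 0 j == 0).
      by exists j; rewrite (eqP uj) addn0.
    move: even_n; rewrite -{1}[n]card_ord -sum1_card.
    suff -> : (\sum_(i < n) 1 = weight u)%N by rewrite odd_u.
    rewrite weight_sum; apply: eq_bigr => i _.
    by case: (F2_cases (u 0 i)) (u1 i) => ->.
  (* Here |u| is even, and any nonzero coordinate of u will do. *)
  have [j uj|u1] := pickP (fun j => u 0 j == 1).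
    by exists j; rewrite uj addn1 /= odd_u.
  case/negP: u_neq0; apply/eqP/rowP => i; rewrite mxE.
  by case: (F2_cases (u 0 i)) (u1 i) => ->.
pose F v := qsign (weight v) * qsign (weight (v + u)).
pose R : comNzRingType := int.
have flipF v : F (v + delta_mx 0 j) = - F v.
  rewrite /F addrAC !qsign_flip !exprD sign_weightD mxE sign_F2D.
  have sgn_u : (-1) ^+ weight u * (-1) ^+ (u 0 j == 1) = -1 :> R.
    by rewrite -exprD -signr_odd uj.
  have sq k : (-1) ^+ k * (-1) ^+ k = 1 :> R by rewrite -expr2 sqrr_sign.
  have cancel_sq (a b c d x y : int) : a * a = 1 -> b * b = 1 -> c * d = -1 ->
      a * b * x * (a * c * (b * d) * y) = - (x * y).
    move=> aa bb cd; transitivity (a * a * (b * b) * (c * d) * (x * y)).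
      by ring.
    by rewrite aa bb cd; ring.
  exact: cancel_sq (sq _) (sq _) sgn_u.
suff: \sum_v F v = - \sum_v F v.
  by rewrite -/F; move: (\sum_v F v) => S SN; lia.
rewrite {1}(reindex_inj (addIr (delta_mx 0 j))) -sumrN.
by apply: eq_bigr => v _; rewrite flipF.
Qed.

(** Both sides are the product over the coordinates of the sum of c^a over the
    two values 0 and 1 of a. *)
Lemma sum_expr_weight (R : comNzRingType) (c : R) :
  \sum_(v : 'rV['F_2]_n) c ^+ weight v = (1 + c) ^+ n.
Proof.
pose g (a : 'F_2) := c ^+ (a == 1).
have -> : 1 + c = \sum_a g a by rewrite big_ord_recl big_ord1.
rewrite -[n in RHS]card_ord -prodr_const bigA_distr_bigA /=.
rewrite (reindex (fun f : {ffun 'I_n -> 'F_2} => \row_j f j)) /=; last first.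
  exists (fun v => [ffun j => v 0 j]) => [f _ | v _].
    by apply/ffunP => j; rewrite ffunE mxE.
  by apply/rowP => j; rewrite mxE ffunE.
apply: eq_bigr => f _; rewrite weight_sum expr_sum.
by apply: eq_bigr => j _; rewrite mxE.
Qed.

End Weight.

(** * The sum of the quadratic signs *)

Lemma sum_qsign m :
  \sum_(v : 'rV['F_2]_(4 * m + 2)) qsign (weight v) =
    2 * ((-1) ^+ m * 2 ^+ (2 * m)).
Proof.
have i2 : 'i * 'i = -1 :> algC by rewrite -expr2 sqrCi.
have qE k : 2 * (qsign k)%:~R = (1 - 'i) * 'i ^+ k + (1 + 'i) * (- 'i) ^+ k :> algC.
  rewrite qsign_mod4 {2 3}(divn_eq k 4) !exprD ![(_ * 4)%N]mulnC !exprM.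
  have -> : 'i ^+ 4 = 1 :> algC by ring: i2.
  have -> : (- 'i) ^+ 4 = 1 :> algC by ring: i2.
  rewrite !expr1n !mul1r; have := ltn_pmod k (isT : (0 < 4)%N).
  by case: (k %% 4)%N => [|[|[|[|]]]] //= _; ring: i2.
apply: (@intr_inj algC); apply: (mulfI (_ : 2 != 0 :> algC)).
  by rewrite pnatr_eq0.
rewrite rmorph_sum mulr_sumr (eq_bigr _ (fun v _ => qE (weight v))).
rewrite big_split -!mulr_sumr !sum_expr_weight /=.
(* The two conjugate terms differ only by the choice of the square root c. *)
have e4 (c : algC) : c * c = -1 -> (1 + c) ^+ (4 * m + 2) = (- 4) ^+ m * (2 * c).
  move=> c2; rewrite exprD exprM; have -> : (1 + c) ^+ 4 = - 4 by ring: c2.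
  by congr (_ * _); ring: c2.
rewrite !e4 ?mulrNN // !(rmorphM, rmorphXn, rmorphN) /= exprM -exprMn.
by rewrite (_ : -1%:~R * 2%:~R ^+ 2 = - 4 :> algC); [ring: i2 | ring].
Qed.

(** * The connection set *)

Definition low_weight {n} (v : 'rV['F_2]_n) : bool := (weight v %% 4 < 2)%N.

Lemma weight_eq0 {n} (v : 'rV['F_2]_n) : (weight v == 0%N) = (v == 0).
Proof.
apply/idP/eqP => [|->]; last by rewrite weight0.
rewrite /weight cards_eq0 => /eqP/setP v0; apply/rowP => i; rewrite mxE.
by have := v0 i; rewrite !inE; case: (F2_cases (v 0 i)) => ->.
Qed.

Lemma connection_set_orbits n :
  S0 n :|: Sres n 1 =
  \bigcup_(i in [set i : 'I_n.+1 | (i != 0%N :> nat) && (i %% 4 < 2)%N]) orb n i.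
Proof.
apply/setP => v; rewrite inE; apply/orP/bigcupP => [[] /bigcupP[i] | [i]].
- by case/andP=> i_neq0 /eqP i_mod vi; exists i; rewrite // inE i_neq0 i_mod.
- move=> /eqP i_mod vi; exists i; rewrite // inE i_mod andbT.
  by apply: contra_eq_neq i_mod => ->.
rewrite inE => /andP[i_neq0 i_mod] vi.
have [i0|i1] : (i %% 4 = 0 \/ i %% 4 = 1)%N by lia.
  by left; apply/bigcupP; exists i; rewrite // i_neq0 i0.
by right; apply/bigcupP; exists i; rewrite // i1.
Qed.

Lemma mem_connection_set n (v : 'rV['F_2]_n) :
  (v \in S0 n :|: Sres n 1) = (v != 0) && low_weight v.
Proof.
rewrite connection_set_orbits -weight_eq0; apply/bigcupP/andP => [[i]|[v0 v_low]].
  by rewrite !inE /low_weight => i_low /eqP ->; apply/andP.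
have lt_v : (weight v < n.+1)%N by rewrite ltnS -[leqRHS]card_ord max_card.
by exists (Ordinal lt_v); rewrite !inE //= v0.
Qed.

Lemma Cay_connection_set n (x y : 'rV['F_2]_n) :
  Cay (S0 n :|: Sres n 1) x y = (x != y) && low_weight (x + y).
Proof.
have -> : Cay (S0 n :|: Sres n 1) x y = (- x + y \in S0 n :|: Sres n 1) by [].
by rewrite mem_connection_set oppv addr_eq0 oppv.
Qed.

(** * Counting by character sums *)

Lemma card_setz (T : finType) (P : pred T) :
  #|[set z | P z]|%:Z = \sum_z (P z : nat)%:Z.
Proof.
rewrite -sum1_card big_mkcond /= (big_morph Posz PoszD (erefl _)).
by apply: eq_bigr => z _; rewrite inE; case: (P z).
Qed.

Lemma low_weight_qsign {n} (v : 'rV['F_2]_n) :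
  2 * (low_weight v : nat)%:Z = 1 + qsign (weight v).
Proof. by rewrite qsign_mod4 /low_weight; case: ifP. Qed.

Lemma sum_shift n (V : nmodType) (F : 'rV['F_2]_n -> V) x :
  \sum_z F (x + z) = \sum_z F z.
Proof. by rewrite [RHS](reindex_inj (addrI x)). Qed.

Lemma card_low_weight m (x : 'rV['F_2]_(4 * m + 2)) :
  #|[set z | low_weight (x + z)]|%:Z =
  2 ^+ (4 * m + 1) + (-1) ^+ m * 2 ^+ (2 * m).
Proof.
apply: (mulfI (_ : 2 != 0 :> int)) => //.
rewrite card_setz (sum_shift _ _ (fun v => (low_weight v : nat)%:Z)) mulr_sumr.
rewrite (eq_bigr _ (fun v _ => low_weight_qsign v)) big_split /= sum_qsign.
rewrite sumr_const card_mx card_Fp // mul1n mulrDr -exprS -addnS.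
by rewrite natrX.
Qed.

(** Expanding the product of the indicators (1 + q) / 2 leaves two sums of q and a
    cross term, which vanishes by orthogonality. *)
Lemma card_low_weight2 m (x y : 'rV['F_2]_(4 * m + 2)) : x != y ->
  #|[set z | low_weight (x + z) && low_weight (y + z)]|%:Z =
  2 ^+ (4 * m) + (-1) ^+ m * 2 ^+ (2 * m).
Proof.
move=> neq_xy; apply: (mulfI (_ : 4 != 0 :> int)) => //.
pose q (v : 'rV['F_2]_(4 * m + 2)) : int := qsign (weight v).
have qE z : 4 * (low_weight (x + z) && low_weight (y + z) : nat)%:Z =
    1 + q (x + z) + q (y + z) + q (x + z) * q (y + z).
  have := low_weight_qsign (x + z); have := low_weight_qsign (y + z).
  rewrite -/(q (x + z)) -/(q (y + z)).
  by case: (low_weight (x + z)); case: (low_weight (y + z)) => /=; nia.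
have orth : \sum_z q (x + z) * q (y + z) = 0.
  have xy_neq0 : x + y != 0 by rewrite addr_eq0 oppv.
  have even_n : ~~ odd (4 * m + 2) by lia.
  rewrite -[RHS](qsign_orthogonal _ _ even_n xy_neq0).
  rewrite -[RHS](sum_shift _ _ (fun v => q v * q (v + (x + y))) x).
  by apply: eq_bigr => z _; rewrite addrACA addvv add0r [z + y]addrC.
rewrite card_setz mulr_sumr (eq_bigr _ (fun z _ => qE z)) !big_split /= orth.
rewrite !sum_shift !sum_qsign sumr_const card_mx card_Fp // mul1n natrX exprD.
by ring.
Qed.

(** * Neighbours and common neighbours *)

Lemma low_weight_addvv n (x : 'rV['F_2]_n) : low_weight (x + x).
Proof. by rewrite addvv /low_weight weight0. Qed.

(** The zero vector has low weight but is excluded from the connection set, so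
    x itself is counted on the left only. *)
Lemma card_neighbours n (x : 'rV['F_2]_n) :
  #|[set z | low_weight (x + z)]| =
  (1 + #|[set z | Cay (S0 n :|: Sres n 1) x z]|)%N.
Proof.
rewrite (cardsD1 x) inE low_weight_addvv; congr (_ + _)%N.
by apply: eq_card => z; rewrite !inE Cay_connection_set eq_sym.
Qed.

(** The two additional solutions z = x and z = y are present only when x + y has
    low weight. *)
Lemma card_common_neighbours n (x y : 'rV['F_2]_n) : x != y ->
  #|[set z | low_weight (x + z) && low_weight (y + z)]| =
  (low_weight (x + y) * 2 +
   #|common_neighbours (Cay (S0 n :|: Sres n 1)) x y|)%N.
Proof.
move=> neq_xy; rewrite (cardsD1 x) (cardsD1 y) !inE !low_weight_addvv.
rewrite (eq_sym y) neq_xy andbT [y + x]addrC /= muln2 -addnn -addnA.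
do 2!congr (_ + _)%N; apply: eq_card => z; rewrite !inE !Cay_connection_set.
by rewrite (eq_sym x) (eq_sym y) andbACA andbA [(z != y) && _]andbC.
Qed.

Lemma connected_of_common_neighbours (V : finType) (e : rel V) : symmetric e ->
  (forall x y, x != y -> ~~ e x y -> (0 < #|common_neighbours e x y|)%N) ->
  forall x y, connect e x y.
Proof.
move=> e_sym e_common x y; have [->|neq_xy] := eqVneq x y; first exact: connect0.
have [exy|/(e_common _ _ neq_xy)] := boolP (e x y); first exact: connect1.
rewrite card_gt0 => /set0Pn[z]; rewrite inE => /andP[exz eyz].
by apply: connect_trans (connect1 exz) _; apply: connect1; rewrite e_sym.
Qed.

Theorem theorem7 (m : nat) (hm : (0 < m)%N) :
  let n := (4 * m + 2)%N in
  let D := S0 n :|: Sres n 1 in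
  orbit_connection_set D /\
  strongly_regular (Cay D)
    (2%:Z ^+ (4 * m + 2))
    (2%:Z ^+ (4 * m + 1) + (-1) ^+ m * 2%:Z ^+ (2 * m) - 1)
    (2%:Z ^+ (4 * m) + (-1) ^+ m * 2%:Z ^+ (2 * m) - 2)
    (2%:Z ^+ (4 * m) + (-1) ^+ m * 2%:Z ^+ (2 * m)).
Proof.
move=> n D; split.
  split; last by exists [set i : 'I_n.+1 | (i != 0%N :> nat) && (i %% 4 < 2)%N];
    exact: connection_set_orbits.
  split; first by rewrite mem_connection_set eqxx.
  by apply/setP => v; rewrite mem_invg (oppv n v : v^-1%g = v).
have D_sym : symmetric (Cay D).
  by move=> x y; rewrite !Cay_connection_set eq_sym addrC.
have nonadj (x y : 'rV['F_2]_n) : x != y -> ~~ Cay D x y ->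
    #|common_neighbours (Cay D) x y|%:Z =
    2%:Z ^+ (4 * m) + (-1) ^+ m * 2%:Z ^+ (2 * m).
  move=> neq_xy; rewrite Cay_connection_set neq_xy /= => /negPf high_xy.
  by rewrite -(card_low_weight2 m _ _ neq_xy) card_common_neighbours // high_xy.
split; first by split=> // x; rewrite Cay_connection_set eqxx.
split.
  apply: connected_of_common_neighbours => // x y neq_xy nadj_xy.
  rewrite -ltz_nat (nonadj x y) //.
  have lt_pow : (2 ^+ (2 * m) < 2 ^+ (4 * m) :> int)%R.
    by rewrite ltr_eXn2l //; lia.
  by rewrite -signr_odd; case: (odd m) => /=;
    rewrite ?mulN1r ?mul1r ?subr_gt0 ?addr_gt0 ?exprn_gt0.
split; first by rewrite card_mx card_Fp // mul1n -natz natrX.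
split.
  move=> x; rewrite -(card_low_weight m x) card_neighbours PoszD.
  by rewrite addrAC subrr add0r.
split=> // x y; rewrite Cay_connection_set => /andP[neq_xy low_xy].
rewrite -(card_low_weight2 m _ _ neq_xy) card_common_neighbours // low_xy.
by rewrite PoszD addrAC subrr add0r.
Qed.
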